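(* Let $a,b,\mu_\ast,r_\ast,L>0$ be constants, and for $\alpha\in\mathbb R$ put $r_\alpha=r_\ast\exp\!\left(-\frac{\mu_\ast+b\alpha}{a}\right)$. Consider the ageing law, with state evolution $\dot\alpha=\frac{r_\ast e^{-\alpha}-r}{L}$, i.e. $\dot\alpha+A(\alpha)=f(r)$ with $$A(\alpha)=-\frac{r_\ast}{L}e^{-\alpha}\quad(\alpha\in\mathbb R),\qquad f(r)=-\frac rL\quad(r\ge0),$$ and with friction coefficient $\mu:[0,\infty)\times\mathbb R\to\mathbb R$ given either by the regularised law $\mu(r,\alpha)=a\,\operatorname{asinh}\!\left(\frac{r}{2r_\alpha}\right)$ or by the truncated law $\mu(r,\alpha)=a\log\max\!\left(1,\frac{r}{r_\alpha}\right)$. Then in either case: (1) $\mu$ is nondecreasing and continuous in its first argument; (2) there is a constant $L_\mu$ such that $|\mu(r,\alpha)-\mu(r,\beta)|\le L_\mu|\alpha-\beta|$ for all $\alpha,\beta\in\mathbb R$ and $r\ge0$; (3) there is a constant $C_\mu$ such that $0\le\mu(r,\alpha)\le C_\mu(1+r+|\alpha|)$ for all $\alpha\in\mathbb R$ and $r\ge0$; (4) $A$ is nondecreasing and continuous; (5) there is a constant $L_f$ such that $|f(r)-f(v)|\le L_f|r-v|$ for all $r,v\ge0$.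
   Context: In rate-and-state friction the friction coefficient $\mu(r,\alpha)$ depends on the slip rate $r\ge0$ and a scalar state $\alpha\in\mathbb R$. The original ageing law uses $\mu=\mu_\ast+a\log\frac{r}{r_\ast}+b\alpha=a\log\frac{r}{r_\alpha}$, which is negative for small $r$; the regularised and truncated laws replace $\log z$ at $z=r/r_\alpha$ by $\operatorname{asinh}(z/2)$ and $\log^+z=\log\max(1,z)$, respectively. *)

(* Defs.v *)
From Stdlib Require Import Reals.
Open Scope R_scope.

Definition r_alpha (a b mu_star r_star alpha : R) : R :=
  r_star * exp (- ((mu_star + b * alpha) / a)).

(* The two friction laws and [ageing_f] are meaningful for slip rates [0 <= r]
   only; their values at negative [r] are artefacts of totality. *)
Definition mu_regularised (a b mu_star r_star r alpha : R) : R :=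
  a * arcsinh (r / (2 * r_alpha a b mu_star r_star alpha)).

Definition mu_truncated (a b mu_star r_star r alpha : R) : R :=
  a * ln (Rmax 1 (r / r_alpha a b mu_star r_star alpha)).

Definition ageing_A (r_star L alpha : R) : R := - (r_star / L) * exp (- alpha).

Definition ageing_f (L r : R) : R := - (r / L).

(* The state evolution [alpha' = (r_star * exp (- alpha) - r) / L] is
   [alpha' + A alpha = f r]. *)
Lemma ageing_rate_split (r_star L r alpha : R) :
  (r_star * exp (- alpha) - r) / L = ageing_f L r - ageing_A r_star L alpha.
Proof. unfold ageing_f, ageing_A, Rdiv; ring. Qed.

Definition slip_rates (r : R) : Prop := 0 <= r.

(* Main.v *)
Require Import Defs.
From Stdlib Require Import Reals.
From Stdlib Require Import Lra.
Open Scope R_scope.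

(** Both laws have the form [mu r alpha = a * g (r / r_alpha)] for a profile [g]
    that vanishes at [0], is continuous and nondecreasing, and grows at most
    like the logarithm: multiplying the argument by [exp d], with [0 <= d],
    raises [g] by at most [d].  The last property holds because
    [g z = ln (h z)] with [h (k * z) <= k * h z] for [1 <= k], where
    [h z = z / 2 + sqrt ((z / 2) ^ 2 + 1)] or [h z = max 1 z].

    These properties ([friction_profile]) give everything about [mu].
    Monotonicity and continuity in [r] are inherited from [g].  The state enters
    only through [r_alpha], and passing from [alpha] to [beta] multiplies
    [r / r_alpha] by [exp (b * (beta - alpha) / a)]; logarithmic growth turns
    this factor into an increment of at most [b * |beta - alpha|], so [b] is a
    Lipschitz constant ([profile_lipschitz_state]).  Finally, [g z <= g 1 + z]
    bounds [mu r 0] by an affine function of [r], and the Lipschitz estimate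
    carries the bound over to every [alpha] ([profile_linear_growth]). *)

(** * Profiles of at most logarithmic growth *)

(** Growth is stated with a factor [exp d] rather than differentially because
    the truncated profile has a kink at [1]. *)
Record friction_profile (g : R -> R) : Prop := {
  profile_0 : g 0 = 0;
  profile_incr : forall y z, 0 <= y -> y <= z -> g y <= g z;
  profile_cont : continuity g;
  profile_log_growth :
    forall d z, 0 <= d -> 0 <= z -> g (exp d * z) <= g z + d
}.

Lemma ln_le_weak (x y : R) : 0 < x -> x <= y -> ln x <= ln y.
Proof.
  intros hx [hxy | ->]; [left; now apply ln_increasing | right; reflexivity].
Qed.

Lemma exp_ge_1 (d : R) : 0 <= d -> 1 <= exp d.
Proof. intros hd. pose proof (exp_ineq1_le d). lra. Qed.

Lemma ln_growth (p q d : R) : 0 < p -> 0 < q -> q <= exp d * p ->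
  ln q <= ln p + d.
Proof.
  intros hp hq hqp.
  rewrite <- (ln_exp d) at 1. rewrite Rplus_comm, <- ln_mult by
    (assumption || apply exp_pos).
  now apply ln_le_weak.
Qed.

Lemma arcsinh_arg_pos (x : R) : 0 <= x -> 0 < x + sqrt (x ^ 2 + 1).
Proof.
  intros hx. apply Rplus_le_lt_0_compat; [assumption|].
  apply sqrt_lt_R0. nra.
Qed.

(** The root is subhomogeneous because
    [(k * x) ^ 2 + 1 <= k ^ 2 * (x ^ 2 + 1)] when [1 <= k]. *)
Lemma arcsinh_log_growth (d x : R) : 0 <= d -> 0 <= x ->
  arcsinh (exp d * x) <= arcsinh x + d.
Proof.
  intros hd hx. pose proof (exp_ge_1 d hd) as hk. unfold arcsinh.
  apply ln_growth; try (apply arcsinh_arg_pos; nra).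
  rewrite Rmult_plus_distr_l. apply Rplus_le_compat_l.
  rewrite <- (sqrt_pow2 (exp d)) at 2 by lra.
  rewrite <- sqrt_mult by nra.
  apply sqrt_le_1; nra.
Qed.

Lemma regularised_profile : friction_profile (fun z => arcsinh (z / 2)).
Proof.
  split.
  - replace (0 / 2) with 0 by field. apply arcsinh_0.
  - intros y z _ hyz. apply arcsinh_le. lra.
  - intros z. apply (continuity_pt_comp (fun z => z / 2) arcsinh).
    + apply continuity_pt_mult; [apply derivable_continuous_pt, derivable_pt_id |].
      now apply continuity_pt_const.
    + apply derivable_continuous_pt. eexists. apply derivable_pt_lim_arcsinh.
  - intros d z hd hz.
    replace (exp d * z / 2) with (exp d * (z / 2)) by field.
    apply arcsinh_log_growth; lra.
Qed.

Lemma Rmax_1_continuous : continuity (Rmax 1).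
Proof.
  intros x eps heps. exists eps. split; [exact heps|].
  intros y [_ hy]. apply Rle_lt_trans with (2 := hy).
  simpl; unfold Rdist, Rmax, Rabs.
  repeat destruct Rle_dec; repeat destruct Rcase_abs; lra.
Qed.

Lemma truncated_profile : friction_profile (fun z => ln (Rmax 1 z)).
Proof.
  assert (hpos : forall z, 0 < Rmax 1 z)
    by (intros z; pose proof (Rmax_l 1 z); lra).
  split.
  - rewrite Rmax_left by lra. apply ln_1.
  - intros y z _ hyz. apply ln_le_weak; [apply hpos|].
    now apply Rle_max_compat_l.
  - intros z. apply (continuity_pt_comp (Rmax 1) ln); [apply Rmax_1_continuous|].
    apply derivable_continuous_pt. eexists. now apply derivable_pt_lim_ln.
  - intros d z hd hz. pose proof (exp_ge_1 d hd) as hk.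
    apply ln_growth; try apply hpos.
    apply Rmax_lub.
    + pose proof (Rmax_l 1 z). nra.
    + apply Rmult_le_compat_l; [lra | apply Rmax_r].
Qed.

Lemma profile_nonneg (g : R -> R) (z : R) : friction_profile g ->
  0 <= z -> 0 <= g z.
Proof.
  intros hg hz. rewrite <- (profile_0 g hg). now apply (profile_incr g hg).
Qed.

(** Beyond [1], write [z = exp (ln z) * 1] and use [ln z <= z]; below [1],
    monotonicity is enough. *)
Lemma profile_affine_bound (g : R -> R) (z : R) : friction_profile g ->
  0 <= z -> g z <= g 1 + z.
Proof.
  intros hg hz. destruct (Rle_dec z 1) as [hz1 | hz1].
  - pose proof (profile_incr g hg z 1 hz hz1). lra.
  - assert (hln : 0 <= ln z) by (rewrite <- ln_1; apply ln_le_weak; lra).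
    pose proof (profile_log_growth g hg (ln z) 1 hln Rle_0_1) as h.
    rewrite exp_ln, Rmult_1_r in h by lra.
    pose proof (exp_ineq1_le (ln z)) as h'. rewrite exp_ln in h' by lra. lra.
Qed.

(** * Friction coefficients given by a profile *)

Lemma r_alpha_pos (a b mu_star r_star alpha : R) : 0 < r_star ->
  0 < r_alpha a b mu_star r_star alpha.
Proof. intros hr. apply Rmult_lt_0_compat; [exact hr | apply exp_pos]. Qed.

Lemma scaled_rate_nonneg (a b mu_star r_star r alpha : R) : 0 < r_star ->
  0 <= r -> 0 <= r / r_alpha a b mu_star r_star alpha.
Proof.
  intros hr h. apply Rmult_le_pos; [exact h|].
  left. now apply Rinv_0_lt_compat, r_alpha_pos.
Qed.

Lemma r_alpha_shift (a b mu_star r_star alpha beta : R) : a <> 0 ->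
  r_alpha a b mu_star r_star alpha =
  exp (b * (beta - alpha) / a) * r_alpha a b mu_star r_star beta.
Proof.
  intros ha. unfold r_alpha.
  replace (- ((mu_star + b * alpha) / a)) with
    (b * (beta - alpha) / a + - ((mu_star + b * beta) / a)) by (field; assumption).
  rewrite exp_plus. ring.
Qed.

Section ProfileFriction.

Variables (a b mu_star r_star : R) (g : R -> R).
Hypotheses (ha : 0 < a) (hb : 0 < b) (hr : 0 < r_star).
Hypothesis hg : friction_profile g.

Definition profile_mu (r alpha : R) : R :=
  a * g (r / r_alpha a b mu_star r_star alpha).

Lemma profile_mu_incr_rate (r v alpha : R) : 0 <= r -> r <= v ->
  profile_mu r alpha <= profile_mu v alpha.
Proof.
  intros h0 hrv. apply Rmult_le_compat_l; [lra|].
  apply (profile_incr g hg); [now apply scaled_rate_nonneg|].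
  apply Rmult_le_compat_r; [|exact hrv].
  left. now apply Rinv_0_lt_compat, r_alpha_pos.
Qed.

Lemma profile_mu_cont_rate (alpha : R) :
  continuity (fun r => profile_mu r alpha).
Proof.
  intros r. apply (continuity_pt_scal (fun r => g (r / _))).
  apply (continuity_pt_comp (fun r => r / _) g); [|apply (profile_cont g hg)].
  apply continuity_pt_mult; [apply derivable_continuous_pt, derivable_pt_id |].
  now apply continuity_pt_const.
Qed.

Lemma profile_mu_increment_state (alpha beta r : R) : 0 <= r ->
  alpha <= beta ->
  profile_mu r alpha <= profile_mu r beta <= profile_mu r alpha + b * (beta - alpha).
Proof.
  intros h0 hab.
  pose proof (scaled_rate_nonneg a b mu_star r_star r alpha hr h0) as hz.
  assert (hd : 0 <= b * (beta - alpha) / a).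
  { apply Rmult_le_pos; [nra | left; now apply Rinv_0_lt_compat]. }
  assert (hshift : r / r_alpha a b mu_star r_star beta =
    exp (b * (beta - alpha) / a) * (r / r_alpha a b mu_star r_star alpha)).
  { rewrite (r_alpha_shift a b mu_star r_star alpha beta) by lra. field. split.
    - apply Rgt_not_eq. now apply r_alpha_pos.
    - apply Rgt_not_eq, exp_pos. }
  unfold profile_mu. rewrite hshift. split.
  - apply Rmult_le_compat_l; [lra|]. apply (profile_incr g hg); [exact hz|].
    pose proof (exp_ge_1 _ hd). nra.
  - pose proof (profile_log_growth g hg _ _ hd hz) as h.
    apply Rmult_le_compat_l with (r := a) in h; [|lra].
    rewrite Rmult_plus_distr_l in h.
    replace (a * (b * (beta - alpha) / a)) with (b * (beta - alpha)) in h
      by (field; lra).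
    exact h.
Qed.

Lemma profile_lipschitz_state (alpha beta r : R) : 0 <= r ->
  Rabs (profile_mu r alpha - profile_mu r beta) <= b * Rabs (alpha - beta).
Proof.
  intros h0. destruct (Rle_dec alpha beta) as [hab | hab].
  - pose proof (profile_mu_increment_state alpha beta r h0 hab).
    rewrite (Rabs_left1 (alpha - beta)), Rabs_left1; lra.
  - assert (hba : beta <= alpha) by lra.
    pose proof (profile_mu_increment_state beta alpha r h0 hba).
    rewrite (Rabs_right (alpha - beta)), Rabs_right; lra.
Qed.

Lemma profile_mu_nonneg (r alpha : R) : 0 <= r -> 0 <= profile_mu r alpha.
Proof.
  intros h0. apply Rmult_le_pos; [lra|].
  apply profile_nonneg; [exact hg | now apply scaled_rate_nonneg].
Qed.

Lemma profile_linear_growth : exists C : R, forall alpha r, 0 <= r ->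
  profile_mu r alpha <= C * (1 + r + Rabs alpha).
Proof.
  set (r0 := r_alpha a b mu_star r_star 0).
  assert (hg1 : 0 <= a * g 1).
  { apply Rmult_le_pos; [lra|]. apply profile_nonneg; [exact hg | lra]. }
  assert (hr0 : 0 <= a / r0).
  { apply Rmult_le_pos; [lra|]. left. now apply Rinv_0_lt_compat, r_alpha_pos. }
  (* The coefficients of [1], [r] and [Rabs alpha], added up. *)
  exists (a * g 1 + a / r0 + b). intros alpha r h0.
  pose proof (profile_lipschitz_state alpha 0 r h0) as hlip.
  rewrite Rminus_0_r in hlip.
  pose proof (Rle_abs (profile_mu r alpha - profile_mu r 0)) as habs.
  pose proof (Rabs_pos alpha) as hal.
  assert (hmu0 : profile_mu r 0 <= a * g 1 + a / r0 * r).
  { replace (a * g 1 + a / r0 * r) with (a * (g 1 + r / r0))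
      by (unfold Rdiv; ring).
    apply Rmult_le_compat_l; [lra|].
    apply profile_affine_bound; [exact hg | now apply scaled_rate_nonneg]. }
  nra.
Qed.

End ProfileFriction.

(** * The regularised and truncated laws *)

(** The two laws are treated as one from here on.  In the regularised law the
    factor [2] moves from [2 * r_alpha] into the profile. *)
Lemma law_has_profile (a b mu_star r_star : R) (mu : R -> R -> R) :
  0 < r_star ->
  (forall r alpha, 0 <= r ->
     mu r alpha = mu_regularised a b mu_star r_star r alpha) \/
  (forall r alpha, 0 <= r ->
     mu r alpha = mu_truncated a b mu_star r_star r alpha) ->
  exists g, friction_profile g /\
    forall r alpha, 0 <= r -> mu r alpha = profile_mu a b mu_star r_star g r alpha.
Proof.
  intros hr [law | law].
  - exists (fun z => arcsinh (z / 2)). split; [exact regularised_profile|].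
    intros r alpha h0. rewrite law by exact h0.
    unfold mu_regularised, profile_mu. do 2 f_equal. field.
    apply Rgt_not_eq. now apply r_alpha_pos.
  - exists (fun z => ln (Rmax 1 z)). split; [exact truncated_profile|].
    exact law.
Qed.

Lemma continue_in_ext (f h : R -> R) (D : R -> Prop) (x : R) :
  (forall y, D y -> f y = h y) -> D x -> continuity_pt h x -> continue_in f D x.
Proof.
  intros hfh hx hc eps heps. destruct (hc eps heps) as [d [hd hlim]].
  exists d. split; [exact hd|]. intros y [[hy hne] hdist].
  rewrite (hfh y hy), (hfh x hx). apply hlim.
  split; [split; [exact I | exact hne] | exact hdist].
Qed.

(** * The ageing law *)

Lemma ageing_A_increasing (r_star L : R) : 0 < r_star -> 0 < L ->
  increasing (ageing_A r_star L).
Proof.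
  intros hr hL x y hxy. unfold ageing_A.
  rewrite !Ropp_mult_distr_l_reverse. apply Ropp_le_contravar.
  apply Rmult_le_compat_l.
  - left. now apply Rdiv_lt_0_compat.
  - destruct hxy as [hxy | ->]; [left; apply exp_increasing; lra | right; reflexivity].
Qed.

Lemma ageing_A_continuity (r_star L : R) : continuity (ageing_A r_star L).
Proof.
  intros x. apply (continuity_pt_scal (fun alpha => exp (- alpha))).
  apply (continuity_pt_comp Ropp exp).
  - apply (continuity_pt_opp id), derivable_continuous_pt, derivable_pt_id.
  - apply derivable_continuous_pt, derivable_pt_exp.
Qed.

Lemma ageing_f_dist (L r v : R) : 0 < L ->
  Rabs (ageing_f L r - ageing_f L v) = / L * Rabs (r - v).
Proof.
  intros hL. unfold ageing_f.
  replace (- (r / L) - - (v / L)) with (- (/ L * (r - v)))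
    by (unfold Rdiv; ring).
  rewrite Rabs_Ropp, Rabs_mult, (Rabs_right (/ L)); [reflexivity|].
  left. now apply Rinv_0_lt_compat.
Qed.

(* Stdlib reals. [mu] is constrained on [0 <= r] only, and [continue_in] is
   continuity relative to the half-line, so nothing is said at [r < 0]. *)
Theorem proposition2 (a b mu_star r_star L : R)
  (ha : 0 < a) (hb : 0 < b) (hmu : 0 < mu_star) (hr : 0 < r_star) (hL : 0 < L)
  (mu : R -> R -> R)
  (law : (forall r alpha, 0 <= r ->
            mu r alpha = mu_regularised a b mu_star r_star r alpha) \/
         (forall r alpha, 0 <= r ->
            mu r alpha = mu_truncated a b mu_star r_star r alpha)) :
  (forall alpha,
     (forall r v, 0 <= r -> r <= v -> mu r alpha <= mu v alpha) /\
     (forall r, 0 <= r -> continue_in (fun s => mu s alpha) slip_rates r)) /\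
  (exists L_mu : R, forall alpha beta r, 0 <= r ->
     Rabs (mu r alpha - mu r beta) <= L_mu * Rabs (alpha - beta)) /\
  (exists C_mu : R, forall alpha r, 0 <= r ->
     0 <= mu r alpha <= C_mu * (1 + r + Rabs alpha)) /\
  (increasing (ageing_A r_star L) /\ continuity (ageing_A r_star L)) /\
  (exists L_f : R, forall r v, 0 <= r -> 0 <= v ->
     Rabs (ageing_f L r - ageing_f L v) <= L_f * Rabs (r - v)).
Proof.
  destruct (law_has_profile a b mu_star r_star mu hr law) as [g [hg hmug]].
  split; [|split; [|split; [|split; [split|]]]].
  - intros alpha. split.
    + intros r v h0 hrv. rewrite !hmug by lra. now apply profile_mu_incr_rate.
    + intros r h0.
      apply continue_in_ext with
        (h := fun s => profile_mu a b mu_star r_star g s alpha);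
        [intros s hs; now apply hmug | exact h0 |].
      now apply profile_mu_cont_rate.
  - exists b. intros alpha beta r h0. rewrite !hmug by exact h0.
    now apply profile_lipschitz_state.
  - destruct (profile_linear_growth a b mu_star r_star g ha hb hr hg) as [C hC].
    exists C. intros alpha r h0. rewrite hmug by exact h0. split.
    + now apply profile_mu_nonneg.
    + now apply hC.
  - now apply ageing_A_increasing.
  - apply ageing_A_continuity.
  - exists (/ L). intros r v _ _. right. now apply ageing_f_dist.
Qed.
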